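(* Let $p=\frac12$. Let $(\overline{b}_l)_{l=1}^\infty$ and $(\underline{b}_l)_{l=1}^\infty$ be two sequences taking values in $[0,1]$. Suppose that a $(-2,1)$-list system satisfies $$T_{n-1}\,\underline{b}_{l_{n-1}}\le B_n\le T_{n-1}\,\overline{b}_{l_{n-1}}\qquad\text{for every coup } n \text{ with } 1\le n\le N,$$ and that at least one of the following conditions holds: 1. $\lim_{l\to\infty}\overline{b}_l=0$; 2. $\inf_{l}\underline{b}_l>0$. Then $\mathbb{E}[B^\star]=\infty$.
   Context: A gambler plays a sequence of independent coups, each won with probability $p$ and lost with probability $1-p$. A $(-2,1)$-list system consists of a target sequence $\{T_n\}_{n\ge0}$, a bet sequence $\{B_n\}_{n\ge1}$ and a length sequence $\{l_n\}_{n\ge0}$ evolving as follows. (1) Initially $T_0>0$ is a (deterministic) real number and $l_0\in\{1,2,\dots\}$. (2) At the $n$-th coup the system makes a bet $B_n\in[0,T_{n-1}]$, which may depend on the entire history (i.e. on the initial data and the outcomes of coups $1,\dots,n-1$). Then $T_n=T_{n-1}-B_n$ and $l_n=(l_{n-1}-2)_+$ if the coup is won, and $T_n=T_{n-1}+B_n$ and $l_n=l_{n-1}+1$ if the coup is lost, where $x_+=\max\{x,0\}$. (3) Termination condition: let $N=\inf\{n: l_n=0\}$ (possibly $\infty$). The system must satisfy $T_n=l_n=0$ for all $n\ge N$ and $B_n=0$ for all $n>N$. (So the evolution rule in (2) applies up to coup $N$.) The largest bet size is $B^\star=\max_{1\le n\le N}B_n$ if $N<\infty$, and $B^\star=\sup_{n\ge1}B_n$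 if $N=\infty$. *)

(* Defs.v *)
From HB Require Import structures.
From mathcomp Require Import all_boot all_order all_algebra.
From mathcomp Require Import finmap.
From mathcomp Require Import all_classical all_reals all_analysis.
Set Implicit Arguments.
Unset Strict Implicit.
Unset Printing Implicit Defensive.
Import Order.TTheory GRing.Theory Num.Theory.
Import numFieldNormedType.Exports.
Local Open Scope classical_set_scope.
Local Open Scope ring_scope.

(* The event [win n] is "coup n is won"; coups are numbered from 1 and [win 0]
   plays no role.  Independence is mutual independence of these events. *)
Record independent_coups (d : measure_display) (Omega : measurableType d)
    (R : realType) (P : probability Omega R) (p : R) (win : nat -> set Omega)
    : Prop := IndependentCoups {
  coups_measurable : forall n, (0 < n)%N -> measurable (win n);
  coups_proba : forall n, (0 < n)%N -> P (win n) = p%:E;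
  coups_independent : forall J : {fset nat},
    (forall j, j \in J -> (0 < j)%N) ->
    P (\bigcap_(j in [set` J]) win j) = (\prod_(j <- J) P (win j))%E
}.

Definition history (Omega : Type) (win : nat -> set Omega) (n : nat)
    (w : Omega) : seq bool :=
  [seq w \in win i | i <- iota 1 n].

(* N = inf {n : l_n = 0}, as an extended real: +oo when the set is empty. *)
Definition termination_time (R : realType) (Omega : Type)
    (l : nat -> Omega -> nat) (w : Omega) : \bar R :=
  ereal_inf [set n%:R%:E | n in [set n : nat | l n w = 0%N]].

(* The evolution is required for every outcome w.  The value B 0 is junk, and
   (l n w - 2)%N is truncated subtraction, i.e. (l_n - 2)_+. *)
Record list_system (R : realType) (Omega : Type) (win : nat -> set Omega)
    (T0 : R) (l0 : nat) (T B : nat -> Omega -> R) (l : nat -> Omega -> nat)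
    (N := @termination_time R Omega l) : Prop := ListSystem {
  ls_T0_gt0 : 0 < T0;
  ls_l0_gt0 : (0 < l0)%N;
  ls_T0 : forall w, T 0%N w = T0;
  ls_l0 : forall w, l 0%N w = l0;
  ls_bet_history : forall n, exists f : seq bool -> R,
    forall w, B n.+1 w = f (history win n w);
  ls_bet_range : forall n w, 0 <= B n.+1 w <= T n w;
  ls_win : forall n w, (n.+1%:R%:E <= N w)%E -> win n.+1 w ->
    T n.+1 w = T n w - B n.+1 w /\ l n.+1 w = (l n w - 2)%N;
  ls_loss : forall n w, (n.+1%:R%:E <= N w)%E -> ~ win n.+1 w ->
    T n.+1 w = T n w + B n.+1 w /\ l n.+1 w = (l n w).+1;
  ls_stop : forall n w, (N w <= n%:R%:E)%E -> T n w = 0 /\ l n w = 0%N;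
  ls_stop_bet : forall n w, (N w < n%:R%:E)%E -> B n w = 0
}.

(* B* = sup of B_n over the integers 1 <= n <= N.  For N < +oo the index set
   is finite and nonempty, so this is the maximum; for N = +oo it is the
   supremum over all n >= 1. *)
Definition largest_bet (R : realType) (Omega : Type)
    (B : nat -> Omega -> R) (l : nat -> Omega -> nat) (w : Omega) : \bar R :=
  ereal_sup [set (B n w)%:E | n in
    [set n : nat | (0 < n)%N /\ (n%:R%:E <= termination_time R l w)%E]].

(* Main.v *)
(* Suppose E[B^star] < oo.  The length has negative drift, so N < oo almost surely
   and B_n -> 0; dominated convergence by B^star gives E[B_n] -> 0, while
   E[T_n] = T_0 for all n since T is a martingale.  If blo >= c > 0, then
   c T_n <= B_(n+1), a contradiction.  If bhi -> 0, choose K with bhi <= 1/10 beyond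
   K.  From a length at most K, at most K consecutive wins bring the target to 0, so
   T_n is bounded by the bets along that streak, whence E[T_n; l_n <= K] -> 0.
   Beyond K, even under the measure with density T_n / T_0 the length still
   drifts downwards, because the bets are small; hence E[T_n z^(l_n); l_n > K] is
   contracted at each coup, up to a multiple of E[T_n; l_n <= K], and also tends
   to 0.  Together these contradict E[T_n] = T_0. *)
Require Import Defs.
From HB Require Import structures.
From mathcomp Require Import all_boot all_order all_algebra.
From mathcomp Require Import finmap.
From mathcomp Require Import all_classical all_reals all_analysis.
From mathcomp Require Import measurable_realfun lra.
Set Implicit Arguments.
Unset Strict Implicit.
Unset Printing Implicit Defensive.
Import Order.TTheory GRing.Theory Num.Theory.
Import numFieldNormedType.Exports.
Local Open Scope classical_set_scope.
Local Open Scope ring_scope.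

(** * Averages over the binary tree of win/loss histories *)

Fixpoint histories (n : nat) : seq (seq bool) :=
  if n is m.+1 then
    flatten [seq [:: rcons h true; rcons h false] | h <- histories m]
  else [:: [::]].

(** The expectation of a function of [n] independent fair coups. *)
Definition mean (R : realType) (n : nat) (G : seq bool -> R) : R :=
  2^-1 ^+ n * \sum_(h <- histories n) G h.

Lemma big_historiesS (V : nmodType) (n : nat) (G : seq bool -> V) :
  \sum_(h <- histories n.+1) G h =
  \sum_(h <- histories n) (G (rcons h true) + G (rcons h false)).
Proof.
rewrite /= big_flatten /= big_map; apply: eq_bigr => h _.
by rewrite big_cons big_cons big_nil addr0.
Qed.

Lemma size_histories (n : nat) (h : seq bool) :
  h \in histories n -> size h = n.
Proof.
elim: n h => [|n IHn] h /=; first by rewrite inE => /eqP ->.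
move=> /flatten_mapP[g /IHn <-]; rewrite !inE.
by case/orP => /eqP ->; rewrite size_rcons.
Qed.

Lemma mean0 (R : realType) (G : seq bool -> R) : mean 0 G = G [::].
Proof. by rewrite /mean big_cons big_nil addr0 expr0 mul1r. Qed.

(** Conditioning on the first [n] coups: the last one is averaged out. *)
Lemma meanS (R : realType) (n : nat) (G : seq bool -> R) :
  mean n.+1 G = mean n (fun h => (G (rcons h true) + G (rcons h false)) / 2).
Proof. by rewrite /mean big_historiesS -mulr_suml exprSr -mulrA [2^-1 * _]mulrC. Qed.

Lemma meanD (R : realType) (n : nat) (F G : seq bool -> R) :
  mean n (fun h => F h + G h) = mean n F + mean n G.
Proof. by rewrite /mean big_split mulrDr. Qed.

Lemma meanZ (R : realType) (n : nat) (c : R) (G : seq bool -> R) :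
  mean n (fun h => c * G h) = c * mean n G.
Proof. by rewrite /mean -mulr_sumr mulrCA. Qed.

Lemma ler_mean (R : realType) (n : nat) (F G : seq bool -> R) :
  (forall h, F h <= G h) -> mean n F <= mean n G.
Proof.
move=> FG; apply: ler_wpM2l; last exact: ler_sum.
by rewrite exprn_ge0// invr_ge0.
Qed.

Lemma mean_ge0 (R : realType) (n : nat) (G : seq bool -> R) :
  (forall h, 0 <= G h) -> 0 <= mean n G.
Proof.
move=> G0; rewrite mulr_ge0 ?sumr_ge0//.
Qed.

(* A list system as functions of the history [h] of the coups already played:
   [B h] is the bet at the next coup, i.e. B_(n+1) when [size h = n]. *)
Record list_tree (R : realType) (T0 : R) (l0 : nat) (T B : seq bool -> R)
    (l : seq bool -> nat) : Prop := ListTree {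
  lt_T0 : T [::] = T0;
  lt_l0 : l [::] = l0;
  lt_B : forall h, 0 <= B h <= T h;
  lt_T_win : forall h, T (rcons h true) = T h - B h;
  lt_T_loss : forall h, T (rcons h false) = T h + B h;
  lt_l_win : forall h, l (rcons h true) = (l h - 2)%N;
  lt_l_loss : forall h, l (rcons h false) = if l h == 0%N then 0%N else (l h).+1;
  lt_stop : forall h, l h = 0%N -> T h = 0
}.

(** * One-coup estimates for the target and the length *)

Lemma list_tree_T_ge0 (R : realType) (T0 : R) (l0 : nat)
    (T B : seq bool -> R) (l : seq bool -> nat) (h : seq bool) :
  list_tree T0 l0 T B l -> 0 <= T h.
Proof. by move=> L; have /andP[B0 BT] := lt_B L h; apply: le_trans BT. Qed.

(** The target is a martingale: the changes [- B] and [+ B] are equally likely. *)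
Lemma mean_T (R : realType) (T0 : R) (l0 : nat)
    (T B : seq bool -> R) (l : seq bool -> nat) (n : nat) :
  list_tree T0 l0 T B l -> mean n T = T0.
Proof.
move=> L; elim: n => [|n IHn]; first by rewrite mean0 (lt_T0 L).
rewrite meanS -IHn; congr mean; apply/funext => h.
by rewrite (lt_T_win L) (lt_T_loss L); lra.
Qed.

(* One coup multiplies the weight [(5/4)^l] by (16/25 + 5/4) / 2 = 189/200 on
   average. *)
Lemma mean_active (R : realType) (T0 : R) (l0 : nat)
    (T B : seq bool -> R) (l : seq bool -> nat) (n : nat) :
  list_tree T0 l0 T B l ->
  mean n (fun h => (0 < l h)%N%:R) <= (5 / 4) ^+ l0 * (189 / 200) ^+ n :> R.
Proof.
move=> L; apply: (@le_trans _ _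
  (mean n (fun h => (0 < l h)%N%:R * (5 / 4) ^+ l h))).
  apply: ler_mean => h; case: (0 < l h)%N; rewrite ?mul0r// mul1r.
  by apply: exprn_ege1; lra.
elim: n => [|n IHn].
  by rewrite mean0 (lt_l0 L) expr0 mulr1; case: (0 < l0)%N;
    rewrite ?mul1r// mul0r exprn_ge0//; lra.
rewrite meanS exprS mulrCA; apply: le_trans (ler_wpM2l _ IHn); last by lra.
rewrite -meanZ; apply: ler_mean => h; rewrite (lt_l_win L) (lt_l_loss L).
(* From length 1 or 2 a win ends the play and the indicator removes its term; only from length 3 on
   do both outcomes count. *)
case: (l h) => [|[|[|k]]] /=.
- by rewrite !mul0r; lra.
- by rewrite /= !mul0r !mul1r expr1 expr2; lra.
- by rewrite /= !mul0r !mul1r expr2 !exprS expr0; lra.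
rewrite subn2 /= !mul1r !exprS.
by have : 0 <= (5 / 4) ^+ k :> R; [rewrite exprn_ge0//; lra | nra].
Qed.

(* [T = B + (T - B)]: the bet, plus the target that is left after a win. *)
Lemma mean_T_short (R : realType) (T0 : R) (l0 : nat)
    (T B : seq bool -> R) (l : seq bool -> nat) (m n : nat) :
  list_tree T0 l0 T B l ->
  mean n (fun h => (l h <= m.+1.*2)%N%:R * T h) <=
  mean n B + 2 * mean n.+1 (fun h => (l h <= m.*2)%N%:R * T h).
Proof.
move=> L; rewrite meanS -meanZ -meanD; apply: ler_mean => h.
have T0h g := list_tree_T_ge0 g L.
have /andP[B0 BT] := lt_B L h.
have : 0 <= (l (rcons h false) <= m.*2)%N%:R * T (rcons h false) by rewrite mulr_ge0.
rewrite (lt_T_win L) (lt_l_win L).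
case: (leqP (l h) m.+1.*2) => lm; last first.
  rewrite mul0r => H; have : 0 <= (l h - 2 <= m.*2)%N%:R * (T h - B h).
    by rewrite mulr_ge0 ?subr_ge0.
  by move=> H1; lra.
(* A win takes length at most [m.+1.*2] to at most [m.*2]; the factor 2 in the statement offsets the
   probability of that win. *)
have -> : (l h - 2 <= m.*2)%N by rewrite leq_subLR.
by rewrite !mul1r => H; lra.
Qed.

(* With bets [B = b T], [b <= 1/10], the weight [(5/4)^l * T] is multiplied on
   average by ((1 - b) 16/25 + (1 + b) 5/4) / 2 < 49/50. *)
Lemma mean_T_long (R : realType) (T0 : R) (l0 : nat)
    (T B : seq bool -> R) (l : seq bool -> nat) (K n : nat) :
  list_tree T0 l0 T B l ->
  (forall h, (K < l h)%N -> B h <= T h / 10) ->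
  mean n.+1 (fun h => (K < l h)%N%:R * (5 / 4) ^+ l h * T h) <=
  49 / 50 * mean n (fun h => (K < l h)%N%:R * (5 / 4) ^+ l h * T h) +
  (5 / 4) ^+ K.+1 * mean n (fun h => (l h <= K)%N%:R * T h).
Proof.
move=> L small; rewrite meanS -!meanZ -meanD; apply: ler_mean => h.
have Th0 g := list_tree_T_ge0 g L.
have /andP[B0 BT] := lt_B L h.
have z0 k : 0 <= (5 / 4) ^+ k :> R by rewrite exprn_ge0//; lra.
rewrite (lt_T_win L) (lt_T_loss L) (lt_l_win L) (lt_l_loss L).
case: ltnP => lK; case: (leqP (l h) K) => [lK'|lK'] //=.
- by move: (leq_trans lK (leq_subr _ _)); rewrite ltnNge lK'.
- have {}small := small _ lK'.
  case E : (l h) lK lK' => [|[|k]]//=; rewrite subn2 /= => lK lK'.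
  rewrite (leqW lK') !mul1r mul0r mulr0 addr0 !exprS.
  by have := z0 k; move: ((5/4)^+k) => x x0; nra.
(* From length at most [K], only a loss at length exactly [K] leads above [K]; there
   [T + B <= 2 T]. *)
- rewrite !mul0r mulr0 !add0r !mul1r; case: ltnP => lK2; last first.
    by rewrite !mul0r mulr_ge0.
  have -> : (if l h == 0 then 0 else (l h).+1)%N = K.+1.
    by case: eqP lK2 => [//|_]; rewrite ltnS => ?; congr S; apply/eqP; rewrite eqn_leq lK'.
  by rewrite !mul1r; have := z0 K.+1; nra.
(* Here the length is [K + 1] or [K + 2]: a win brings it down to at most [K], so only the loss term
   remains. *)
- case E : (l h) lK lK' => [|k]//= lK lK'.
  rewrite (leqW lK') !mul0r !mul1r mulr0 addr0 add0r.
  have {}small := small h; rewrite E in small.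
  have {}small := small lK'.
  rewrite exprSr [in leRHS]exprSr.
  rewrite exprSr.
  by have := z0 k; move: ((5/4)^+k) => x x0; nra.
Qed.

(** * The mean bet cannot tend to 0 *)

(** Once [a] is below [e / 2 * (1 - r)], iteration gives a geometric term plus [e / 2], the fixed
    point of [x -> r x + e / 2 * (1 - r)]. *)
Lemma cvg0_contraction (R : realType) (r : R) (a c : nat -> R) :
  0 <= r < 1 -> (forall n, 0 <= c n) -> (forall n, c n.+1 <= r * c n + a n) ->
  a @ \oo --> 0 -> c @ \oo --> 0.
Proof.
move=> /andP[r0 r1] c0 ca /cvgr0Pnorm_le a0; apply/cvgr0Pnorm_le => e e0.
have d0 : 0 < e / 2 * (1 - r) by rewrite mulr_gt0 ?divr_gt0 ?subr_gt0.
have [n0 _ an0] := a0 _ d0.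
have ck k : c (k + n0)%N <= c n0 * r ^+ k + e / 2.
  elim: k => [|k IHk]; first by rewrite add0n expr0 mulr1 lerDl divr_ge0 ?ltW.
  have := an0 (k + n0)%N (leq_addl _ _).
  rewrite ler_norml => /andP[_ ak].
  rewrite addSn (le_trans (ca _))// exprS.
  have := ler_wpM2l r0 IHk; set x := r ^+ k => H; nra.
have /cvgr0Pnorm_le/(_ (e / 2)) : (fun k => c n0 * r ^+ k) @ \oo --> 0.
  by apply: cvg_geometric; rewrite ger0_norm.
rewrite divr_gt0// => /(_ isT)[k0 _ gk0].
exists (k0 + n0)%N => // n /= n_ge.
have n0n : (n0 <= n)%N by apply: leq_trans n_ge; rewrite leq_addl.
have := gk0 (n - n0)%N; rewrite /= leq_subRL// addnC n_ge => /(_ isT).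
rewrite ler_norml => /andP[_ gn].
have := ck (n - n0)%N; rewrite subnK// ger0_norm//; lra.
Qed.

(** Induction on the number of wins that bring the length to 0, where the target is 0; each win
    costs one shift of [n]. *)
Lemma cvg_mean_T_short (R : realType) (T0 : R) (l0 : nat)
    (T B : seq bool -> R) (l : seq bool -> nat) (m : nat) :
  list_tree T0 l0 T B l -> mean n B @[n --> \oo] --> 0 ->
  mean n (fun h => (l h <= m.*2)%N%:R * T h) @[n --> \oo] --> 0.
Proof.
move=> L B0; have T0h g := list_tree_T_ge0 g L.
elim: m => [|m IHm].
  rewrite (_ : (fun n => _) = fun=> 0); first exact: cvg_cst.
  apply/funext => n; rewrite /mean big1 ?mulr0// => h _.
  by rewrite leqn0; case: eqP => [/(lt_stop L) ->|_]; rewrite ?mulr0 ?mul0r.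
apply: (@squeeze_cvgr _ _ _ _ (fun=> 0) (fun n => mean n B +
    2 * mean n.+1 (fun h => (l h <= m.*2)%N%:R * T h))).
- near=> n; rewrite (mean_T_short _ _ L) andbT mean_ge0// => h.
  by rewrite mulr_ge0.
- exact: cvg_cst.
rewrite -(addr0 0); apply: cvgD => //; rewrite -(mulr0 2).
by apply: cvgMl_tmp; move: IHm; rewrite -cvg_shiftS.
Unshelve. all: by end_near. Qed.

Lemma mean_bets_not_cvg0 (R : realType) (bhi blo : nat -> R) (T0 : R) (l0 : nat)
    (T B : seq bool -> R) (l : seq bool -> nat) :
  list_tree T0 l0 T B l -> 0 < T0 ->
  (forall k, (0 < k)%N -> 0 <= blo k) ->
  (forall h, (0 < l h)%N -> T h * blo (l h) <= B h <= T h * bhi (l h)) ->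
  bhi k @[k --> \oo] --> 0 \/
    0 < inf [set blo k | k in [set k : nat | (0 < k)%N]] ->
  ~ (mean n B @[n --> \oo] --> 0).
Proof.
move=> L T00 blo0 bet hcond B0; have Tge0 g := list_tree_T_ge0 g L.
suff : T0 <= 0 by rewrite leNgt T00.
case: hcond => [/cvgr0Pnorm_le/(_ 10^-1)|].
- rewrite invr_gt0 ltr0n => /(_ isT)[K0 _ K0P].
  (* [K] is even to fit [cvg_mean_T_short], and at least [K0], so beyond it bets are at most a tenth
     of the target. *)
  pose K := K0.*2; pose z : R := 5 / 4.
  have small h : (K < l h)%N -> B h <= T h / 10.
    move=> Kl; have /andP[_ Bh] := bet h (leq_ltn_trans (leq0n _) Kl).
    apply: le_trans Bh _; apply: ler_wpM2l => //.
    apply: le_trans (ler_norm _) _; apply: K0P => /=.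
    by rewrite (leq_trans _ (ltnW Kl))// /K -addnn leq_addl.
  have a0 := cvg_mean_T_short K0 L B0; rewrite -/K in a0.
  have c0 : mean n (fun h => (K < l h)%N%:R * z ^+ l h * T h) @[n --> \oo] --> 0.
    apply: (@cvg0_contraction _ (49 / 50) (fun n =>
      z ^+ K.+1 * mean n (fun h => (l h <= K)%N%:R * T h))).
    + by apply/andP; split; lra.
    + by move=> n; apply: mean_ge0 => h; rewrite !mulr_ge0// exprn_ge0// /z; lra.
    + by move=> n; exact: mean_T_long L small.
    + by rewrite -(mulr0 (z ^+ K.+1)); exact: cvgMl_tmp.
  (* Since [z ^+ l h >= 1], the short part and the weighted long part together dominate [T], whose
     mean stays [T0]. *)
  rewrite -(addr0 0); apply: (cvgr_to_ge (cvgD a0 c0)); near=> n.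
  rewrite -(mean_T n L) fctE -meanD; apply: ler_mean => h /=.
  case: leqP => _; rewrite ?mul1r ?mul0r ?addr0 ?add0r//.
  by rewrite ler_peMl// exprn_ege1// /z; lra.
(* Here [c * T h <= B h] for every history, so [c * T0] is at most the vanishing mean bet. *)
- set c := inf _ => c_gt0.
  rewrite -(pmulr_rle0 _ c_gt0).
  apply: (cvgr_to_ge B0); near=> n.
  rewrite -(mean_T n L) -meanZ; apply: ler_mean => h /=.
  have [l0h|lh] := posnP (l h).
    by rewrite (lt_stop L l0h) mulr0; have /andP[] := lt_B L h.
  have /andP[Bh _] := bet _ lh; apply: le_trans Bh.
  rewrite mulrC ler_wpM2l//; apply: ge_inf; last by exists (l h).
  (* [inf] is a lower bound only for a set bounded below; 0 bounds this one. *)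
  by exists 0 => _ [k k0 <-]; exact: blo0.
Unshelve. all: by end_near. Qed.

(** * The law of the history of the coups *)

Lemma historyS (Omega : Type) (win : nat -> set Omega) (n : nat) (w : Omega) :
  history win n.+1 w = rcons (history win n w) (w \in win n.+1).
Proof. by rewrite /history -{1}[n.+1]addn1 iotaD map_cat cats1 add1n. Qed.

Lemma size_history (Omega : Type) (win : nat -> set Omega) (n : nat) (w : Omega) :
  size (history win n w) = n.
Proof. by rewrite size_map size_iota. Qed.

Lemma history_rcons_true (Omega : Type) (win : nat -> set Omega) (n : nat)
    (h : seq bool) :
  [set w | history win n.+1 w = rcons h true] =
  [set w | history win n w = h] `&` win n.+1.
Proof.
apply/seteqP; split => w /=; rewrite historyS.
  by move=> /rcons_inj[<- /set_mem].
by move=> [-> /mem_set ->].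
Qed.

Lemma history_rcons_false (Omega : Type) (win : nat -> set Omega) (n : nat)
    (h : seq bool) :
  [set w | history win n.+1 w = rcons h false] =
  [set w | history win n w = h] `\` win n.+1.
Proof.
apply/seteqP; split => w /=; rewrite historyS.
  by move=> /rcons_inj[<- /negbT/negP wn]; split => // /mem_set.
by move=> [-> wn]; rewrite memNset.
Qed.

(** The events [history win n w = h] partition the sample space, so a function of the history is a
    finite combination of indicators. *)
Lemma sum_history (R : realType) (Omega : Type) (win : nat -> set Omega)
    (n : nat) (G : seq bool -> R) (w : Omega) :
  \sum_(h <- histories n) G h * \1_[set w | history win n w = h] w =
  G (history win n w).
Proof.
elim: n G => [|n IHn] G.
  by rewrite big_cons big_nil addr0 indicE mem_set// mulr1.
rewrite big_historiesS historyS -(IHn (fun h => G (rcons h (w \in win n.+1)))).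
apply: eq_bigr => h _.
rewrite history_rcons_true history_rcons_false !indicE in_setI in_setD.
by case: (w \in win _); rewrite ?andbT ?andbF /= ?mulr0 ?addr0 ?add0r.
Qed.

Section coups.
Context (d : measure_display) (Omega : measurableType d) (R : realType)
  (P : probability Omega R) (win : nat -> set Omega).
Hypothesis hcoups : independent_coups P 2^-1 win.

Lemma measurable_history (n : nat) (h : seq bool) :
  measurable [set w | history win n w = h].
Proof.
elim: n h => [|n IHn] h.
  have [->|h0] := eqVneq h [::].
    by rewrite (_ : [set _ | _] = setT)//; apply/seteqP; split.
  rewrite (_ : [set _ | _] = set0)//; apply/seteqP; split => // w /= h0'.
  by move: h0; rewrite -h0' eqxx.
have mw : measurable (win n.+1) by apply: (coups_measurable hcoups).
case: (lastP h) => [|g b].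
  by rewrite (_ : [set _ | _] = set0)//; apply/seteqP; split.
case: b; first by rewrite history_rcons_true; exact: measurableI.
by rewrite history_rcons_false; exact: measurableD.
Qed.

(** Independence is stated for wins only. Carrying a set [J] of later wins lets the induction on the
    last coup treat a loss as a difference of two such events. *)
Lemma proba_history_wins (h : seq bool) (J : {fset nat}) :
  (forall j, j \in J -> (size h < j)%N) ->
  P ([set w | history win (size h) w = h] `&` \bigcap_(j in [set` J]) win j) =
  (2^-1 ^+ (size h + #|` J|))%:E.
Proof.
elim/last_ind: h J => [|h b IHh] J hJ.
  rewrite (_ : [set w | _] = setT); last by apply/seteqP; split.
  rewrite setTI (coups_independent hcoups)// add0n.
  rewrite (eq_big_seq (fun=> (2^-1)%:E)) => [|j jJ]; last first.
    by rewrite (coups_proba hcoups)// (leq_ltn_trans (leq0n _) (hJ j jJ)).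
  rewrite prodEFin; congr EFin.
  by rewrite big_const_seq count_predT iter_mulr_1.
rewrite size_rcons in hJ *.
have hJ' j : j \in J -> (size h < j)%N by move=> /hJ/ltnW.
have hJ1 j : j \in ((size h).+1 |` J)%fset -> (size h < j)%N.
  by rewrite !inE => /orP[/eqP ->//|/hJ'].
have nJ : (size h).+1 \notin J by apply/negP => /hJ; rewrite ltnn.
have E : [set w | history win (size h) w = h] `&`
      \bigcap_(j in [set` J]) win j `&` win (size h).+1 =
    [set w | history win (size h) w = h] `&`
      \bigcap_(j in [set` ((size h).+1 |` J)%fset]) win j.
  rewrite -setIA; congr (_ `&` _); apply/seteqP; split => w.
    move=> [wJ wh] j /=; rewrite !inE => /orP[/eqP ->//|]; exact: wJ.
  move=> wJ; split => [j /= jJ|]; apply: wJ => /=; rewrite !inE ?eqxx//.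
  by rewrite jJ orbT.
have PE : P ([set w | history win (size h) w = h] `&`
      \bigcap_(j in [set` J]) win j `&` win (size h).+1) =
    (2^-1 ^+ ((size h).+1 + #|` J|))%:E.
  by rewrite E IHh// cardfsU1 nJ add1n addnS.
case: b.
  by rewrite history_rcons_true setIAC.
have mW : measurable (\bigcap_(j in [set` J]) win j).
  apply: bigcap_measurableType => j /= /hJ jJ.
  by apply: (coups_measurable hcoups); exact: leq_ltn_trans jJ.
have mH := measurable_history (size h) h.
(* For a loss, removing the event with a win, of probability [x], from one of probability [2 x]
   leaves [x]. *)
rewrite history_rcons_false setDE setIAC -setDE measureD; last 3 first.
- exact: measurableI.
- exact: (coups_measurable hcoups).
- by rewrite (le_lt_trans (probability_le1 _ _)) ?ltry//; exact: measurableI.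
move: PE; rewrite /= => ->; rewrite IHh//= -EFinB; congr EFin.
by rewrite addSn exprS; lra.
Qed.

Lemma proba_history (h : seq bool) :
  P [set w | history win (size h) w = h] = (2^-1 ^+ size h)%:E.
Proof.
have := @proba_history_wins h fset0 (fun j (jJ : j \in fset0) => match notF jJ with end).
by rewrite cardfs0 addn0 (_ : [set` fset0] = set0) ?bigcap_set0 ?setIT//;
  apply/seteqP; split.
Qed.

(** An event of positive probability is nonempty; this gives an outcome for every node of the
    tree. *)
Lemma history_surj (h : seq bool) : exists w, history win (size h) w = h.
Proof.
apply/not_existsP => nw; have := proba_history h.
rewrite (_ : [set w | _] = set0); last by apply/seteqP; split => // w /nw.
rewrite measure0 => /eqP; rewrite eqe eq_sym expf_eq0 invr_eq0.
by rewrite pnatr_eq0 andbF.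
Qed.

Lemma measurable_fun_history (n : nat) (G : seq bool -> R) :
  measurable_fun setT (fun w => G (history win n w)).
Proof.
under eq_fun do rewrite -sum_history.
apply: measurable_sum => h; apply: measurable_funM => //.
by apply: measurable_indic; exact: measurable_history.
Qed.

Lemma integral_history (n : nat) (G : seq bool -> R) :
  (forall h, 0 <= G h) ->
  (\int[P]_w (G (history win n w))%:E)%E = (mean n G)%:E.
Proof.
move=> G0; under eq_integral do rewrite -sum_history -sumEFin.
rewrite ge0_integral_sum//; last 2 first.
- move=> h; apply/measurable_EFinP; apply: measurable_funM => //.
  by apply: measurable_indic; exact: measurable_history.
- by move=> h w _; rewrite lee_fin mulr_ge0.
rewrite /mean mulr_sumr -sumEFin; apply: eq_big_seq => h /size_histories hn.
under eq_integral do rewrite EFinM.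
rewrite ge0_integralZl_EFin//; last first.
  apply/measurable_EFinP/measurable_indic; exact: measurable_history.
rewrite integral_indic ?setIT//; last exact: measurable_history.
by have := proba_history h; rewrite hn /= => ->; rewrite -EFinM mulrC.
Qed.

End coups.

(** * From list systems to functions of the history *)

Section list_system_history.
Context (R : realType) (Omega : Type) (win : nat -> set Omega) (T0 : R)
  (l0 : nat) (T B : nat -> Omega -> R) (l : nat -> Omega -> nat).
Hypothesis hsys : list_system win T0 l0 T B l.

(** Length 0 is absorbing by [ls_stop], so a positive [l n w] excludes every zero up to [n] and the
    infimum is at least [n + 1]. *)
Lemma list_system_active (n : nat) (w : Omega) :
  (n.+1%:R%:E <= termination_time R l w)%E <-> (0 < l n w)%N.
Proof.
split=> [nN|ln].
  rewrite lt0n; apply/eqP => ln0; move: nN; apply/negP; rewrite -ltNge.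
  apply: (@le_lt_trans _ _ n%:R%:E); last by rewrite lte_fin ltr_nat.
  by apply: ereal_inf_lbound; exists n.
apply: le_ereal_inf_tmp => _ [m /= lm0 <-]; rewrite lee_fin ler_nat ltnNge.
apply/negP => mn; move: ln; rewrite lt0n => /eqP; apply.
apply: (ls_stop hsys _).2; apply: (@le_trans _ _ m%:R%:E).
  by apply: ereal_inf_lbound; exists m.
by rewrite lee_fin ler_nat.
Qed.

Lemma list_system_stopped (n m : nat) (w : Omega) :
  l n w = 0%N -> (n <= m)%N -> T m w = 0 /\ l m w = 0%N /\ B m.+1 w = 0.
Proof.
move=> ln nm.
have [Tm lm] : T m w = 0 /\ l m w = 0%N.
  apply: (ls_stop hsys); apply: (@le_trans _ _ n%:R%:E).
    by apply: ereal_inf_lbound; exists n.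
  by rewrite lee_fin ler_nat.
(* The bet lies between 0 and the target, which is 0. *)
split=> //; split=> //; apply/eqP.
by have := ls_bet_range hsys m w; rewrite Tm -eq_le eq_sym.
Qed.

(** After termination both sides vanish, so the evolution rule extends beyond [N]. *)
Lemma list_system_win (n : nat) (w : Omega) : win n.+1 w ->
  T n.+1 w = T n w - B n.+1 w /\ l n.+1 w = (l n w - 2)%N.
Proof.
move=> wn; have [ln0|ln] := posnP (l n w); last first.
  by apply: (ls_win hsys) wn; exact/list_system_active.
have [Tn [_ ->]] := list_system_stopped ln0 (leqnn n).
by have [-> [-> _]] := list_system_stopped ln0 (leqnSn n); rewrite Tn ln0 subr0.
Qed.

Lemma list_system_loss (n : nat) (w : Omega) : ~ win n.+1 w ->
  T n.+1 w = T n w + B n.+1 w /\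
  l n.+1 w = if l n w == 0%N then 0%N else (l n w).+1.
Proof.
move=> wn; have [ln0|ln] := posnP (l n w); last first.
  by apply: (ls_loss hsys) wn; exact/list_system_active.
have [Tn [_ ->]] := list_system_stopped ln0 (leqnn n).
by have [-> [-> _]] := list_system_stopped ln0 (leqnSn n); rewrite Tn addr0.
Qed.

Lemma eq_history_bet (n : nat) (w w' : Omega) :
  history win n w = history win n w' -> B n.+1 w = B n.+1 w'.
Proof. by move=> ww'; have [f Bf] := ls_bet_history hsys n; rewrite !Bf ww'. Qed.

Lemma eq_history_target (n : nat) (w w' : Omega) :
  history win n w = history win n w' -> T n w = T n w' /\ l n w = l n w'.
Proof.
elim: n => [|n IHn]; first by rewrite !(ls_T0 hsys) !(ls_l0 hsys).
rewrite !historyS => /rcons_inj[hh ww'].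
have [TT ll] := IHn hh; have BB := eq_history_bet hh.
have [/set_mem wn|/negP wn] := boolP (w \in win n.+1).
  have wn' : win n.+1 w' by apply: set_mem; rewrite -ww' mem_set.
  have [-> ->] := list_system_win wn; have [-> ->] := list_system_win wn'.
  by rewrite TT ll BB.
have wn1 : ~ win n.+1 w by move=> /mem_set.
have wn' : ~ win n.+1 w' by move=> /mem_set; rewrite -ww'.
have [-> ->] := list_system_loss wn1; have [-> ->] := list_system_loss wn'.
by rewrite TT ll BB.
Qed.

(** Each node is evaluated at a chosen outcome with that history; [eq_history_target] and
    [eq_history_bet] make the choice immaterial. *)
Lemma list_system_tree :
  (forall h, exists w, history win (size h) w = h) ->
  exists Th Bh lh, list_tree T0 l0 Th Bh lh /\
    forall n w, [/\ T n w = Th (history win n w),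
      B n.+1 w = Bh (history win n w) & l n w = lh (history win n w)].
Proof.
move=> /choice[pick pickP].
pose Th h := T (size h) (pick h); pose Bh h := B (size h).+1 (pick h).
pose lh h := l (size h) (pick h).
have E n w : [/\ T n w = Th (history win n w),
    B n.+1 w = Bh (history win n w) & l n w = lh (history win n w)].
  rewrite /Th /Bh /lh size_history.
  have hh : history win n w = history win n (pick (history win n w)).
    by have := pickP (history win n w); rewrite size_history.
  by have [-> ->] := eq_history_target hh; rewrite (eq_history_bet hh).
(* The outcome chosen for a child also passes through its parent [h], so both nodes are read off one
   path. *)
have step h b : history win (size h) (pick (rcons h b)) = h /\
    (pick (rcons h b) \in win (size h).+1) = b.
  by have := pickP (rcons h b); rewrite size_rcons historyS => /rcons_inj[].
have Estep h b : [/\ T (size h) (pick (rcons h b)) = Th h,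
    B (size h).+1 (pick (rcons h b)) = Bh h &
    l (size h) (pick (rcons h b)) = lh h].
  by have [hh _] := step h b; have := E (size h) (pick (rcons h b)); rewrite hh.
exists Th, Bh, lh; split=> //; split.
- exact: (ls_T0 hsys).
- exact: (ls_l0 hsys).
- by move=> h; exact: (ls_bet_range hsys).
- move=> h; have [_ /set_mem wn] := step h true.
  have [<- <- _] := Estep h true.
  by have [+ _] := list_system_win wn; rewrite /Th size_rcons.
- move=> h; have [_ /negbT/negP wn] := step h false.
  have [<- <- _] := Estep h false.
  have [|+ _] := @list_system_loss (size h) (pick (rcons h false)).
    by move=> /mem_set.
  by rewrite /Th size_rcons.
- move=> h; have [_ /set_mem wn] := step h true.
  have [_ _ <-] := Estep h true.
  by have [_ +] := list_system_win wn; rewrite /lh size_rcons.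
- move=> h; have [_ /negbT/negP wn] := step h false.
  have [_ _ <-] := Estep h false.
  have [|_ +] := @list_system_loss (size h) (pick (rcons h false)).
    by move=> /mem_set.
  by rewrite /lh size_rcons.
- by move=> h lh0; have [] := list_system_stopped lh0 (leqnn _).
Qed.

(** Lifting the restriction to [n <= N] only adds bets equal to 0, and a supremum over all coups is
    visibly measurable. *)
Lemma largest_betE (w : Omega) :
  largest_bet B l w = esups (fun n => (B n.+1 w)%:E) 0.
Proof.
have B_ge0 n : 0 <= B n.+1 w by have /andP[] := ls_bet_range hsys n w.
apply/eqP; rewrite eq_le; apply/andP; split; apply: ge_ereal_sup => x /=.
  move=> [[|n] [//= _ _] <-]; apply: ereal_sup_ubound.
  by exists n.
move=> [n _ <-]; have [ln0|ln] := posnP (l n w); last first.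
  apply: ereal_sup_ubound; exists n.+1 => //; split=> //.
  exact/list_system_active.
have [_ [_ ->]] := list_system_stopped ln0 (leqnn n).
(* The added zeros lie below [B 1], which is admissible because [l0] is positive. *)
apply: (@le_trans _ _ (B 1%N w)%:E); first by rewrite lee_fin.
apply: ereal_sup_ubound; exists 1%N => //; split=> //.
by apply/list_system_active; rewrite (ls_l0 hsys) (ls_l0_gt0 hsys).
Qed.

End list_system_history.

(** * Almost sure termination and the infinite expectation *)

(** Endless play lies in each event [0 < l n w], whose probability [mean_active] bounds
    geometrically. *)
Lemma list_system_terminates (R : realType) (d : measure_display)
    (Omega : measurableType d) (P : probability Omega R)
    (win : nat -> set Omega) (T0 : R) (l0 : nat)
    (T B : nat -> Omega -> R) (l : nat -> Omega -> nat) :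
  independent_coups P 2^-1 win -> list_system win T0 l0 T B l ->
  P.-negligible [set w | forall n, (0 < l n w)%N].
Proof.
move=> hcoups hsys.
have [Th [Bh [lh [L E]]]] := list_system_tree hsys (history_surj hcoups).
pose A n := [set w | (0 < l n w)%N].
have AE n : \1_(A n) = (fun w => (0 < lh (history win n w))%N%:R) :> (_ -> R).
  apply/funext => w; rewrite indicE; have [_ _ <-] := E n w.
  by congr (_ %:R); congr nat_of_bool; apply/idP/idP => [/set_mem|/mem_set].
have mA n : measurable (A n).
  apply/(@measurable_indicP _ _ R); rewrite AE.
  exact: (measurable_fun_history hcoups n (fun h => (0 < lh h)%N%:R)).
have mI : measurable (\bigcap_n A n) by exact: bigcap_measurable.
have PA n : (P (\bigcap_n A n) <= ((5 / 4) ^+ l0 * (189 / 200) ^+ n)%:E)%E.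
  apply: (@le_trans _ _ (P (A n))).
    by apply: le_measure; rewrite ?inE//; exact: bigcap_inf.
  rewrite -[P (A n)]/(P (A n)) -(setIT (A n)) -integral_indic// AE.
  rewrite (integral_history hcoups n (G := fun h => (0 < lh h)%N%:R))//.
  by rewrite lee_fin; exact: mean_active L.
exists (\bigcap_n A n); split=> //; last by move=> w wl n _; exact: wl.
have PI : P (\bigcap_n A n) \is a fin_num by exact: fin_num_measure.
apply/eqP; rewrite eq_le measure_ge0 andbT -(fineK PI) lee_fin.
have g0 : (fun n => (5 / 4 : R) ^+ l0 * (189 / 200) ^+ n) @ \oo --> 0.
  by apply: cvg_geometric; rewrite ger0_norm; lra.
by apply: (cvgr_to_ge g0); near=> n; rewrite -lee_fin fineK.
Unshelve. all: by end_near. Qed.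

Unset Implicit Arguments.

Theorem theorem2 (R : realType) (d : measure_display)
    (Omega : measurableType d) (P : probability Omega R)
    (win : nat -> set Omega)
    (bhi blo : nat -> R)
    (T0 : R) (l0 : nat)
    (T B : nat -> Omega -> R) (l : nat -> Omega -> nat)
    (hcoups : independent_coups P (2^-1) win)
    (hbhi : forall k, (0 < k)%N -> 0 <= bhi k <= 1)
    (hblo : forall k, (0 < k)%N -> 0 <= blo k <= 1)
    (hsys : list_system win T0 l0 T B l)
    (hbet : forall n w, (n.+1%:R%:E <= termination_time R l w)%E ->
      T n w * blo (l n w) <= B n.+1 w <= T n w * bhi (l n w))
    (hcond : bhi k @[k --> \oo] --> (0 : R) \/
             0 < inf [set blo k | k in [set k : nat | (0 < k)%N]]) :
  (\int[P]_w largest_bet B l w)%E = +oo%E.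
Proof.
have [Th [Bh [lh [L E]]]] := list_system_tree hsys (history_surj hcoups).
have B_ge0 n w : 0 <= B n.+1 w by have /andP[] := ls_bet_range hsys n w.
have mB n : measurable_fun setT (fun w => (B n.+1 w)%:E).
  apply/measurable_EFinP.
  rewrite (_ : B n.+1 = (fun w => Bh (history win n w))).
    exact: (measurable_fun_history hcoups).
  by apply/funext => w; have [] := E n w.
have B_le n w : ((B n.+1 w)%:E <= largest_bet B l w)%E.
  by rewrite (largest_betE hsys); apply: ereal_sup_ubound; exists n.
have mBs : measurable_fun setT (largest_bet B l).
  rewrite (funext (largest_betE hsys)).
  exact: (@measurable_fun_esups _ _ _ _ (fun n w => (B n.+1 w)%:E)).
have Bs_ge0 w : (0 <= largest_bet B l w)%E.
  by apply: le_trans (B_le 0%N w); rewrite lee_fin.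
(* If its integral is finite, the nonnegative largest bet is an integrable bound for all bets. *)
apply/eqP; apply: contraT; rewrite -ltey => Bs_fin; exfalso.
have iBs : P.-integrable setT (largest_bet B l).
  apply/integrableP; split=> //.
  by rewrite (eq_integral (largest_bet B l))// => w _; rewrite gee0_abs.
have Bh0 : mean n Bh @[n --> \oo] --> 0.
  have aeB0 : {ae P, forall w, setT w -> (B n.+1 w)%:E @[n --> \oo] --> 0%E}.
    apply: negligibleS (list_system_terminates hcoups hsys) => w /= nB0 n.
    rewrite lt0n; apply/eqP => ln0; apply: nB0 => _.
    (* Along a terminating path the bets are eventually 0. *)
    apply: cvg_near_cst; exists n => // m /= nm.
    by have [_ [_ ->]] := list_system_stopped hsys ln0 nm.
  have aeBs : {ae P, forall w n, setT w -> (`|(B n.+1 w)%:E| <= largest_bet B l w)%E}.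
    by apply: aeW => w n _; rewrite gee0_abs ?lee_fin.
  have [_ _] := dominated_convergence measurableT mB (measurable_cst 0%E) aeB0 iBs aeBs.
  rewrite integral0 => /fine_cvg /=.
  apply: cvg_trans; apply: near_eq_cvg; near=> n => /=.
  rewrite -[RHS]/(fine (mean n Bh)%:E) -(integral_history hcoups)//; last first.
    by move=> h; have /andP[] := lt_B L h.
  by congr fine; apply: eq_integral => w _; have [_ -> _] := E n w.
apply: (mean_bets_not_cvg0 L (ls_T0_gt0 hsys) _ _ hcond Bh0).
- by move=> k /hblo/andP[].
(* [hbet] concerns outcomes, so the history [h] is first realised by one. *)
- move=> h lh_gt0; have [w wh] := history_surj hcoups h.
  have [TE BE lE] := E (size h) w; rewrite wh in TE BE lE.
  rewrite -TE -BE -lE; apply: hbet.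
  by apply/(list_system_active hsys); rewrite lE.
Unshelve. all: by end_near. Qed.
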